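(* Let $\Sigma_0$ be a known positive definite $p\times p$ matrix, fix $n$, $p$ and $\omega\ge0$, and let $Y_t=\Sigma_0^{-1/2}X_t$, $t=1,\dots,n$. In the Gaussian experiment, almost surely and for every $n$ and $p$: (i) under $\Sigma=\Sigma_0$ (i.e. $X_1,\dots,X_n$ i.i.d. $N_p(0,\Sigma_0)$) the whitened sample $(Y_t)$ has the identity-null law $P_n$, and under the conditional alternative given $H$ (i.e. $X_1,\dots,X_n$ i.i.d. $N_p(0,\Sigma_\omega(H;\Sigma_0))$) it has the law $P_{n,\Sigma_\omega(H)}$; (ii) the mixture likelihood ratios coincide, $g_n^{\Sigma_0}(\omega)(X_1,\dots,X_n)=g_n(\omega)(Y_1,\dots,Y_n)$; (iii) $U_n^{\Sigma_0}(X_1,\dots,X_n)=U_n(Y_1,\dots,Y_n)$.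
   Context: $P_{n,\Sigma}$ is the law of $n$ i.i.d. $N_p(0,\Sigma)$ observations and $P_n=P_{n,I_p}$. $Q_n$ is the GOE law on symmetric $p\times p$ matrices $H$: independent upper-triangular entries, $H_{ij}\sim N(0,1)$ for $i<j$, $H_{ii}\sim N(0,2)$. With $A=\omega H/n$, $\Sigma_\omega(H)=(I_p+A+A^2)^{-1}$ and $\Sigma_\omega(H;\Sigma_0)$ is defined by $\Sigma_\omega^{-1}(H;\Sigma_0)=\Sigma_0^{-1/2}(I_p+A+A^2)\Sigma_0^{-1/2}$. $g_n(\omega)$ is the likelihood ratio with respect to $P_n$ of the mixture $\int P_{n,\Sigma_\omega(H)}\,\mathrm dQ_n(H)$; $g_n^{\Sigma_0}(\omega)$ is the likelihood ratio with respect to $P_{n,\Sigma_0}$ of the mixture $\int P_{n,\Sigma_\omega(H;\Sigma_0)}\,\mathrm dQ_n(H)$. For a sample $x_t=(x_{1t},\dots,x_{pt})'$, $t=1,\dots,n$, $$U_n(x_1,\dots,x_n)=\frac1{n^2}\sum_{i<j}\sum_{t=2}^nx_{it}x_{jt}\sum_{s<t}x_{is}x_{js}+\frac1{2n^2}\sum_i\sum_{t=2}^n(x_{it}^2-1)\sum_{s<t}(x_{is}^2-1),$$ $$U_n^{\Sigma_0}(x_1,\dots,x_n)=\frac1{2n^2}\sum_{1\le s<t\le n}h_{\Sigma_0}(x_s,x_t),\qquad h_{\Sigma_0}(x,y)=(x'\Sigma_0^{-1}y)^2-x'\Sigma_0^{-1}x-y'\Sigma_0^{-1}y+p.$$ 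*)

(* Defs.v *)
From HB Require Import structures.
From mathcomp Require Import all_boot all_order all_algebra.
From mathcomp Require Import all_classical all_reals all_analysis.
From mathcomp Require Import measurable_realfun.

Set Implicit Arguments.
Unset Strict Implicit.
Unset Printing Implicit Defensive.
Import Order.TTheory GRing.Theory Num.Theory.
Local Open Scope classical_set_scope.
Local Open Scope ring_scope.

(* The product sigma-algebra on matrices, generated by the entries; over the
   reals it is the Borel sigma-algebra of 'M[R]_(m, n). *)
Definition measure_matrix_display : measure_display -> measure_display.
Proof. exact. Qed.

Section measurable_matrix.
Context {d} {T : measurableType d}.
Variables m n : nat.

Definition mx_entry_preimages : set (set 'M[T]_(m, n)) :=
  \bigcup_(ij in [set: 'I_m * 'I_n])
    preimage_set_system setT (fun M : 'M[T]_(m, n) => M ij.1 ij.2) measurable.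

Let matrix_set0 : <<s mx_entry_preimages >> set0.
Proof. exact: sigma_algebra0. Qed.

Let matrix_setC A : <<s mx_entry_preimages >> A ->
  <<s mx_entry_preimages >> (~` A).
Proof. exact: sigma_algebraC. Qed.

Let matrix_bigcup (F : (set 'M[T]_(m, n))^nat) :
  (forall i, <<s mx_entry_preimages >> (F i)) ->
  <<s mx_entry_preimages >> (\bigcup_i (F i)).
Proof. exact: sigma_algebra_bigcup. Qed.

HB.instance Definition _ := @isMeasurable.Build (measure_matrix_display d)
  'M[T]_(m, n) <<s mx_entry_preimages >> matrix_set0 matrix_setC matrix_bigcup.

Lemma measurable_mx_entry (i : 'I_m) (j : 'I_n) :
  measurable_fun [set: 'M[T]_(m, n)] (fun M => M i j).
Proof.
move=> _ Y mY; rewrite setTI; apply: sub_sigma_algebra.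
by exists (i, j) => //; exists Y => //; rewrite setTI.
Qed.

Lemma measurable_fun_mx d' (T' : measurableType d') (f : T' -> 'M[T]_(m, n)) :
  (forall i j, measurable_fun setT (fun x => f x i j)) -> measurable_fun setT f.
Proof.
move=> mf; apply: (@measurability _ _ _ _ setT f mx_entry_preimages) => //.
move=> _ [_ [[i j] _ [Y mY <-]] <-].
by rewrite setTI; exact: mf.
Qed.

End measurable_matrix.

Section product_law.
Context {d} {T : measurableType d} {R : realType}.

Definition tuple_cons n (x : T * n.-tuple T) : n.+1.-tuple T :=
  [the n.+1.-tuple T of x.1 :: x.2].

Lemma measurable_tuple_cons n : measurable_fun setT (@tuple_cons n).
Proof. exact: (measurable_cons measurable_fst measurable_snd). Qed.

HB.instance Definition _ n := isMeasurableFun.Build _ _ _ _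
  (@tuple_cons n) (@measurable_tuple_cons n).

(* The law on T^n of independent coordinates with marginals P_0, ..., P_n-1. *)
Fixpoint product_law n : ('I_n -> probability T R) -> probability (n.-tuple T) R
  := match n with
     | 0 => fun _ => \d_([tuple] : 0.-tuple T)
     | m.+1 => fun P =>
         distribution (P ord0 \x product_law (fun i => P (lift ord0 i)))%E
           (@tuple_cons m)
     end.

End product_law.

Section matrices.
Context {R : realType} {p : nat}.
Implicit Types M S : 'M[R]_p.

Definition posdefmx M : Prop :=
  M^T = M /\ forall v : 'cV[R]_p, v != 0 -> 0 < (v^T *m M *m v) 0 0.

Definition possemidefmx M : Prop :=
  M^T = M /\ forall v : 'cV[R]_p, 0 <= (v^T *m M *m v) 0 0.

(* The principal square root (the unique positive semidefinite one); the
   default value 0 is only reached when M is not positive semidefinite. *)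
Definition sqrtmx M : 'M[R]_p := xget 0 [set S | possemidefmx S /\ S *m S = M].

Definition invsqrtmx M : 'M[R]_p := invmx (sqrtmx M).

End matrices.

Section normal_law.
Context {R : realType}.

Definition idTR : measurableTypeR R -> R := idfun.

Lemma measurable_idTR : measurable_fun setT idTR.
Proof. by move=> _ A mA; rewrite setTI. Qed.

HB.instance Definition _ := isMeasurableFun.Build _ _ _ _
  idTR measurable_idTR.

(* normal_prob with the display of the canonical measurable structure of R;
   s is the standard deviation. *)
Definition normal_law (m s : R) : probability R R :=
  distribution (normal_prob m s) idTR.

End normal_law.

Section gaussian.
Context {R : realType} {p : nat}.

Definition normal_transform (M : 'M[R]_p) (z : p.-tuple R) : 'cV[R]_p :=
  M *m \col_i tnth z i.

Lemma measurable_normal_transform M : measurable_fun setT (normal_transform M).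
Proof.
apply: measurable_fun_mx => i j; rewrite /normal_transform.
under eq_fun do rewrite mxE.
apply: measurable_sum => k; under eq_fun do rewrite mxE.
by apply: measurable_funM => //; exact: measurable_tnth.
Qed.

HB.instance Definition _ M := isMeasurableFun.Build _ _ _ _
  (normal_transform M) (measurable_normal_transform M).

(* N_p(0, Sigma), as the law of Sigma^(1/2) Z with Z standard normal. *)
Definition gaussian (Sigma : 'M[R]_p) : probability 'cV[R]_p R :=
  distribution (product_law (fun _ : 'I_p => normal_law (0 : R) 1))
    (normal_transform (sqrtmx Sigma)).

Definition gaussian_sample (n : nat) (Sigma : 'M[R]_p) :
    probability (n.-tuple 'cV[R]_p) R :=
  product_law (fun _ : 'I_n => gaussian Sigma).

Definition whiten (n : nat) (Sigma0 : 'M[R]_p) (x : n.-tuple 'cV[R]_p) :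
    n.-tuple 'cV[R]_p :=
  [tuple invsqrtmx Sigma0 *m tnth x t | t < n].

Lemma measurable_whiten n Sigma0 : measurable_fun setT (@whiten n Sigma0).
Proof.
apply/measurable_fun_tnthP => t; apply: measurable_fun_mx => i j.
under eq_fun do rewrite /= tnth_mktuple mxE.
apply: measurable_sum => k; apply: measurable_funM => //.
exact: (measurableT_comp (measurable_mx_entry k j) (measurable_tnth t)).
Qed.

HB.instance Definition _ n Sigma0 := isMeasurableFun.Build _ _ _ _
  (@whiten n Sigma0) (@measurable_whiten n Sigma0).

End gaussian.

Section goe.
Context {R : realType} {p : nat}.

Definition symmx_of_upper (z : p.-tuple (p.-tuple R)) : 'M[R]_p :=
  \matrix_(i, j) if (i <= j)%N then tnth (tnth z i) j else tnth (tnth z j) i.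

Lemma measurable_symmx_of_upper : measurable_fun setT symmx_of_upper.
Proof.
apply: measurable_fun_mx => i j; under eq_fun do rewrite mxE.
case: (leqP i j) => _.
- exact: (measurableT_comp (measurable_tnth j) (measurable_tnth i)).
- exact: (measurableT_comp (measurable_tnth i) (measurable_tnth j)).
Qed.

HB.instance Definition _ := isMeasurableFun.Build _ _ _ _
  symmx_of_upper measurable_symmx_of_upper.

(* N(0, 2) on the diagonal and N(0, 1) above it; the entries of z below the
   diagonal are not used. *)
Definition goe : probability 'M[R]_p R :=
  distribution
    (product_law (fun i : 'I_p => product_law (fun j : 'I_p =>
       normal_law (0 : R) (if i == j then Num.sqrt 2 else 1))))
    symmx_of_upper.

End goe.

Section alternatives.
Context {R : realType} {p : nat}.
Variables (n : nat) (omega : R).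

(* I + A + A^2 with A = omega H / n *)
Definition precision_omega (H : 'M[R]_p) : 'M[R]_p :=
  let A := (omega / n%:R) *: H in 1%:M + A + A *m A.

Definition Sigma_omega (H : 'M[R]_p) : 'M[R]_p := invmx (precision_omega H).

Definition Sigma_omega_at (Sigma0 H : 'M[R]_p) : 'M[R]_p :=
  invmx (invsqrtmx Sigma0 *m precision_omega H *m invsqrtmx Sigma0).

(* The mixture of the laws P_{n, V H} when H is drawn from the GOE, a law
   carried by the symmetric matrices. *)
Definition goe_mixture (V : 'M[R]_p -> 'M[R]_p) (B : set (n.-tuple 'cV[R]_p)) :
    \bar R :=
  (\int[goe]_(H in [set H : 'M[R]_p | H^T = H]) gaussian_sample n (V H) B)%E.

End alternatives.

(* g is (a version of) the likelihood ratio, i.e. the Radon-Nikodym derivative,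
   of nu with respect to P. *)
Definition is_likelihood_ratio {d} {T : measurableType d} {R : realType}
    (nu : set T -> \bar R) (P : probability T R) (g : T -> \bar R) : Prop :=
  [/\ measurable_fun setT g, forall x, (0 <= g x)%E &
      forall B, measurable B -> nu B = (\int[P]_(x in B) g x)%E].

Section statistics.
Context {R : realType} {n p : nat}.
Implicit Types x : n.-tuple 'cV[R]_p.

(* Observations are indexed from 0: the range t = 2, ..., n becomes
   0 < t < n. *)
Definition U_stat x : R :=
  (n%:R ^+ 2)^-1 *
    (\sum_(i < p) \sum_(j < p | (i < j)%N) \sum_(t < n | (0 < t)%N)
       tnth x t i 0 * tnth x t j 0 *
       \sum_(s < n | (s < t)%N) tnth x s i 0 * tnth x s j 0) +
  (2 * n%:R ^+ 2)^-1 *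
    (\sum_(i < p) \sum_(t < n | (0 < t)%N)
       (tnth x t i 0 ^+ 2 - 1) *
       \sum_(s < n | (s < t)%N) (tnth x s i 0 ^+ 2 - 1)).

Definition h_kernel (Sigma0 : 'M[R]_p) (x y : 'cV[R]_p) : R :=
  let q (u v : 'cV[R]_p) := (u^T *m invmx Sigma0 *m v) 0 0 in
  q x y ^+ 2 - q x x - q y y + p%:R.

Definition U_stat_at (Sigma0 : 'M[R]_p) x : R :=
  (2 * n%:R ^+ 2)^-1 *
    (\sum_(t < n) \sum_(s < n | (s < t)%N)
       h_kernel Sigma0 (tnth x s) (tnth x t)).

End statistics.

(* Main.v *)
Require Import Defs.
From HB Require Import structures.
From mathcomp Require Import all_boot all_order all_algebra.
From mathcomp Require Import all_classical all_reals all_analysis.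
From mathcomp Require Import measurable_realfun ring complex.
Import Order.TTheory GRing.Theory Num.Theory.
Local Open Scope classical_set_scope.
Local Open Scope ring_scope.
Set Implicit Arguments.
Unset Strict Implicit.
Unset Printing Implicit Defensive.

(** Write T for the inverse square root of Sigma0, so that whitening applies T
    to each observation. If X has law N(0, V) then T X has law N(0, T V T), and
    T V T is I for V = Sigma0 and Sigma_omega H for V = Sigma_omega_at Sigma0 H
    ([Sigma_omega_at_whitens]). This gives (i) one observation at a time, and
    independence carries it to the sample ([gaussian_sample_whiten]).

    Since N(0, Sigma) is defined as the law of sqrtmx Sigma * Z, with Z standard
    normal, the law of T X is that of a matrix B times Z where B B^T = T V T but
    B is in general not the symmetric square root of T V T. What has to be shown
    is that the law of B Z depends on B B^T only, that is, that the standard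
    normal law is invariant under orthogonal matrices
    ([std_normal_orthogonal]). Its density with respect to Lebesgue measure is a
    function of the Euclidean norm, so this reduces to the change of variables
    formula for linear maps and Lebesgue measure on R^p
    ([iter_lebesgue_linear]). There, block elimination writes an invertible
    matrix as a product of shears and block diagonal matrices; for shears the
    formula is translation invariance together with Tonelli's theorem, and an
    induction on p takes care of the diagonal blocks. The existence of symmetric
    square roots comes from the spectral theorem ([exists_sqrtmx]).

    For (ii), whitening is a bijection of the sample space that carries
    P_{n,Sigma0} to P_n and, by (i) for every symmetric H, one mixture to the
    other. Hence g composed with whitening is a likelihood ratio of the mixture
    with respect to P_{n,Sigma0} ([likelihood_ratio_whiten]), and so is g0; the
    two agree P_{n,Sigma0}-almost surely because the mixture is finite
    ([likelihood_ratio_unique]). All the laws P_{n,Sigma} with Sigma positive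
    definite have the same null sets, which is the change of variables formula
    once more ([std_normal_null_linear], [gaussian_sample_null_set]), so the
    exceptional set is negligible under each of them.

    Statement (iii) holds at every sample point: x^T Sigma0^-1 y is the inner
    product of T x and T y, and expanding the kernel of U_stat_at in coordinates
    gives the two sums of U_stat ([U_statE]). *)

(** * Integration on the real line *)
Section one_dim.
Context {R : realType}.
Local Notation mu := (@lebesgue_measure R).

Lemma measurable_affine (a b : R) : measurable_fun setT (fun x : R => a * x + b).
Proof. by apply: measurable_funD => //; apply: measurable_funM. Qed.

(* The display of measurableTypeR is the one on which lebesgue_measure is
   defined. *)
Let affineTR (a b : R) (x : measurableTypeR R) : measurableTypeR R := a * x + b.
Let measurable_affineTR a b : measurable_fun setT (affineTR a b).
Proof. exact: measurable_affine. Qed.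

Let ge0_integral_pos_affine (a b : R) (f : R -> \bar R) :
  0 < a -> measurable_fun setT f -> (forall x, 0 <= f x)%E ->
  (\int[mu]_x f (a * x + b)%R = (a^-1)%:E * \int[mu]_x f x)%E.
Proof.
move=> a0 mf f0; pose k := NngNum (ltW a0).
suff : (\int[mu]_x f x = a%:E * \int[mu]_x f (affineTR a b x))%E.
  by move=> ->; rewrite muleA -EFinM mulVf ?gt_eqF// mul1e.
rewrite -[RHS]/(k%:num%:E *
  \int[mu]_(x in affineTR a b @^-1` setT) (f \o affineTR a b) x)%E.
rewrite -ge0_integral_pushforward// -ge0_integral_mscale//.
apply: eq_measure_integral => A mA _; apply: lebesgue_measure_unique => //.
move=> _ [[u v] _ <-]; rewrite /mscale/= /pushforward.
have E : affineTR a b @^-1` `]u, v]%classic = `](u - b) / a, (v - b) / a]%classic.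
  apply/seteqP; split => x /=; rewrite !in_itv/= ltr_pdivrMr// ler_pdivlMr//;
  by rewrite ltrBlDr lerBrDr (mulrC x).
transitivity (a%:E * mu [set` `](u - b) / a, (v - b) / a]%R])%E; last by rewrite -E.
rewrite !lebesgue_measure_itv/= !lte_fin ltr_pM2r ?invr_gt0// ltrD2r.
case: ifP => _; last by rewrite mule0.
by rewrite -!EFinD -EFinM; congr EFin; field; rewrite gt_eqF.
Qed.

(** Lebesgue measure is determined by its values on intervals, which gives the
    case a > 0; negative slopes follow by reflection. *)
Lemma ge0_integral_affine (a b : R) (f : R -> \bar R) :
  a != 0 -> measurable_fun setT f -> (forall x, 0 <= f x)%E ->
  (\int[mu]_x f (a * x + b)%R = (`|a|^-1)%:E * \int[mu]_x f x)%E.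
Proof.
move=> a0 mf f0; have [a_gt0|a_le0] := ltP 0 a.
  by rewrite ger0_norm ?ltW// ge0_integral_pos_affine.
have a_lt0 : a < 0 by rewrite lt_neqAle a0.
rewrite ler0_norm// -(ge0_integral_pos_affine b)// ?oppr_gt0//.
rewrite [RHS](_ : _ = \int[pushforward mu (-%R : _ -> measurableTypeR R)]_x
                        f (- a * x + b)%R)%E; last first.
  by apply: eq_measure_integral => A mA _; exact/esym/lebesgue_measureN.
rewrite ge0_integral_pushforward//.
  by apply: eq_integral => x _ /=; rewrite mulrNN.
exact: measurableT_comp mf (measurable_affine _ _).
Qed.

(** The density of the normal law is a Radon-Nikodym derivative, hence may
    replace the abstract one, for which the formula is known. *)
Lemma ge0_integral_normal_law (f : R -> \bar R) :
  measurable_fun setT f -> (forall x, 0 <= f x)%E ->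
  (\int[normal_law 0 1]_x f x =
   \int[mu]_x ((normal_pdf 0 1 x)%:E * f x))%E.
Proof.
move=> mf f0; rewrite ge0_integral_distribution//.
have dom := @normal_prob_dominates R 0 1.
rewrite -(Radon_Nikodym_SigmaFinite.change_of_variables dom)//.
have mpdf := measurable_normal_pdf (0 : R) 1.
have RNi := Radon_Nikodym_SigmaFinite.f_integrable dom.
apply: ae_eq_integral => //.
- by apply: emeasurable_funM => //; exact: measurable_int RNi.
- by apply: emeasurable_funM => //; exact/measurable_EFinP.
have : ae_eq mu setT (Radon_Nikodym_SigmaFinite.f (normal_prob 0 1) mu)
    (fun x => (normal_pdf 0 1 x)%:E).
  apply: integral_ae_eq => //; first exact/measurable_EFinP.
  by move=> A _ mA; rewrite -Radon_Nikodym_SigmaFinite.f_integral.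
by apply: filterS => x /= E _; rewrite E// muleC.
Qed.

End one_dim.

(** * Lebesgue integration on column vectors *)
Section iterated_lebesgue.
Context {R : realType}.
Local Notation mu := (@lebesgue_measure R).
Local Open Scope ereal_scope.

Definition cons_cv p (x : R) (v : 'cV[R]_p) : 'cV[R]_p.+1 := col_mx x%:M v.

Lemma cons_cv0 p x (v : 'cV[R]_p) : cons_cv x v ord0 0%R = x.
Proof.
have -> : ord0 = lshift p (ord0 : 'I_1) by exact: val_inj.
by rewrite /cons_cv (@col_mxEu _ 1 p) mxE eqxx mulr1n.
Qed.

Lemma cons_cvS p x (v : 'cV[R]_p) i : cons_cv x v (lift ord0 i) 0%R = v i 0%R.
Proof. by rewrite /cons_cv -[lift ord0 i]rshift1 (@col_mxEd _ 1 p). Qed.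

Lemma measurable_cons_cv d (T : measurableType d) p (f : T -> R)
    (g : T -> 'cV[R]_p) : measurable_fun setT f -> measurable_fun setT g ->
  measurable_fun setT (fun t => cons_cv (f t) (g t)).
Proof.
move=> mf mg; apply: measurable_fun_mx => i j.
rewrite ord1; case: (unliftP ord0 i) => [k|] ->.
  under eq_fun do rewrite cons_cvS.
  exact: measurableT_comp (measurable_mx_entry k 0%R) mg.
by under eq_fun do rewrite cons_cv0.
Qed.

Lemma measurable_mulmx_l p q (M : 'M[R]_(q, p)) :
  measurable_fun setT (fun v : 'cV[R]_p => M *m v).
Proof.
apply: measurable_fun_mx => i j; under eq_fun do rewrite mxE.
by apply: measurable_sum => k; apply: measurable_funM => //; exact: measurable_mx_entry.
Qed.

(** The Lebesgue integral over R^p of a nonnegative function, in the form of an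
    iterated integral so that facts about R^p become inductions on p. *)
Fixpoint iter_lebesgue p : ('cV[R]_p -> \bar R) -> \bar R :=
  match p with
  | 0 => fun f => f 0%R
  | p'.+1 => fun f => \int[mu]_x iter_lebesgue (fun v => f (cons_cv x v))
  end.

Lemma iter_lebesgue_ge0 p (f : 'cV[R]_p -> \bar R) :
  (forall v, 0 <= f v) -> 0 <= iter_lebesgue f.
Proof.
elim: p f => [|p IH] f f0 //=; apply: integral_ge0 => x _; exact: IH.
Qed.

Lemma measurable_section_cons d (T : measurableType d) p
    (f : T * 'cV[R]_p.+1 -> \bar R) : measurable_fun setT f ->
  measurable_fun setT (fun z : (T * R) * 'cV[R]_p =>
    f (z.1.1, cons_cv z.1.2 z.2)).
Proof.
move=> mf; apply: (measurableT_comp mf); apply/measurable_fun_pairP; split => /=.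
  exact: measurableT_comp measurable_fst measurable_fst.
apply: measurable_cons_cv; last exact: measurable_snd.
exact: measurableT_comp measurable_snd measurable_fst.
Qed.

(** The parameter t is what makes the induction on p go through: each integrated
    coordinate is first moved into it. *)
Lemma measurable_iter_lebesgue d (T : measurableType d) p
    (f : T * 'cV[R]_p -> \bar R) :
  measurable_fun setT f -> (forall z, 0 <= f z) ->
  measurable_fun setT (fun t => iter_lebesgue (fun v => f (t, v))).
Proof.
elim: p d T f => [|p IH] d T f mf f0 /=.
  by apply: (measurableT_comp mf); exact: measurable_pair2.
have := IH _ _ _ (measurable_section_cons mf) (fun z => f0 _).
move=> /(@measurable_fun_fubini_tonelli_F _ _ T (measurableTypeR R) R mu).
by apply=> z; exact: iter_lebesgue_ge0.
Qed.

End iterated_lebesgue.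

Section iter_lebesgue_theory.
Context {R : realType}.
Local Notation mu := (@lebesgue_measure R).
Local Open Scope ereal_scope.

Lemma measurable_cons_uncurry p (f : 'cV[R]_p.+1 -> \bar R) :
  measurable_fun setT f ->
  measurable_fun setT (fun z : R * 'cV[R]_p => f (cons_cv z.1 z.2)).
Proof.
by move=> mf; apply: (measurableT_comp mf); exact: measurable_cons_cv.
Qed.

Lemma measurable_cons_section p (f : 'cV[R]_p.+1 -> \bar R) x :
  measurable_fun setT f -> measurable_fun setT (fun v => f (cons_cv x v)).
Proof.
by move=> mf; apply: (measurableT_comp mf); exact: measurable_cons_cv.
Qed.

Lemma measurable_iter_lebesgue_cons p (f : 'cV[R]_p.+1 -> \bar R) :
  measurable_fun setT f -> (forall v, 0 <= f v) ->
  measurable_fun setT (fun x => iter_lebesgue (fun v => f (cons_cv x v))).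
Proof.
move=> mf f0.
by apply: (measurable_iter_lebesgue (measurable_cons_uncurry mf)) => z; exact: f0.
Qed.

Lemma cons_cvD p (x y : R) (v w : 'cV[R]_p) :
  (cons_cv x v + cons_cv y w)%R = cons_cv (x + y) (v + w).
Proof. by rewrite /cons_cv (@add_col_mx _ 1 p) -raddfD. Qed.

Lemma cons_cv_eta p (w : 'cV[R]_p.+1) :
  w = cons_cv (w ord0 0%R) (\col_i w (lift ord0 i) 0%R).
Proof.
apply/colP => i; case: (unliftP ord0 i) => [k|] ->.
  by rewrite cons_cvS mxE.
by rewrite cons_cv0.
Qed.

Lemma iter_lebesgue_translate p (w : 'cV[R]_p) (f : 'cV[R]_p -> \bar R) :
  measurable_fun setT f -> (forall v, 0 <= f v) ->
  iter_lebesgue (fun v => f (v + w)%R) = iter_lebesgue f.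
Proof.
elim: p w f => [|p IH] w f mf f0 /=.
  by rewrite add0r; congr f; apply/matrixP => -[].
rewrite (cons_cv_eta w); set y := w _ _; set w' := \col_i _.
transitivity (\int[mu]_x iter_lebesgue (fun v => f (cons_cv (1 * x + y) v))).
  apply: eq_integral => x _; under eq_fun do rewrite cons_cvD.
  rewrite mul1r.
  rewrite (IH w' (fun v => f (cons_cv (x + y) v)))//.
  exact: measurable_cons_section.
rewrite (ge0_integral_affine y (f := fun x => iter_lebesgue (fun v => f (cons_cv x v))))//.
- by rewrite normr1 invr1 mul1e.
- exact: measurable_iter_lebesgue_cons.
- by move=> x; exact: iter_lebesgue_ge0.
Qed.

Lemma iter_lebesgueZ p (k : R) (f : 'cV[R]_p -> \bar R) : (0 <= k)%R ->
  measurable_fun setT f -> (forall v, 0 <= f v) ->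
  iter_lebesgue (fun v => k%:E * f v) = k%:E * iter_lebesgue f.
Proof.
move=> k0; elim: p f => [|p IH] f mf f0 //=.
rewrite -ge0_integralZl//.
- apply: eq_integral => x _; rewrite (IH (fun v => f (cons_cv x v)))//.
  exact: measurable_cons_section.
- exact: measurable_iter_lebesgue_cons.
- by move=> x _; exact: iter_lebesgue_ge0.
Qed.

(** Tonelli's theorem, one coordinate at a time. *)
Lemma iter_lebesgue_swap p (f : R * 'cV[R]_p -> \bar R) :
  measurable_fun setT f -> (forall z, 0 <= f z) ->
  \int[mu]_x iter_lebesgue (fun v => f (x, v)) =
  iter_lebesgue (fun v => \int[mu]_x f (x, v)).
Proof.
elim: p f => [|p IH] f mf f0 //=.
have mf' := measurable_section_cons mf.
have := measurable_iter_lebesgue mf' (fun z => f0 _) => mg.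
rewrite (@fubini_tonelli _ _ (measurableTypeR R) (measurableTypeR R) R mu mu
  (fun z => iter_lebesgue (fun v => f (z.1, cons_cv z.2 v))))//; last first.
  by move=> z; exact: iter_lebesgue_ge0.
apply: eq_integral => y _.
rewrite -(IH (fun z => f (z.1, cons_cv y z.2)))//.
apply: (measurableT_comp mf); apply: measurable_fun_pair => //=.
exact: measurable_cons_cv.
Qed.

(** Used between a function and its product with a positive density, in both
    directions: the density does not change which functions have integral zero.
    *)
Lemma iter_lebesgue_null p (f g : 'cV[R]_p -> \bar R) :
  measurable_fun setT f -> (forall v, 0 <= f v) ->
  measurable_fun setT g -> (forall v, 0 <= g v) ->
  (forall v, f v = 0 -> g v = 0) -> iter_lebesgue f = 0 -> iter_lebesgue g = 0.
Proof.
elim: p f g => [|p IH] f g mf f0 mg g0 fg /=; first exact: fg.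
pose F (h : 'cV[R]_p.+1 -> \bar R) x := iter_lebesgue (fun v => h (cons_cv x v)).
have F0 h x : (forall v, 0 <= h v) -> 0 <= F h x.
  by move=> h0; exact: iter_lebesgue_ge0.
have FE h : (forall v, 0 <= h v) -> \int[mu]_x F h x = \int[mu]_x `|F h x|.
  by move=> h0; apply: eq_integral => x _; rewrite gee0_abs ?F0.
rewrite -/(F f _) -/(F g _) !FE// => /ae_eq_integral_abs Ff.
apply/ae_eq_integral_abs => //; first exact: measurable_iter_lebesgue_cons.
have := Ff measurableT (measurable_iter_lebesgue_cons mf f0).
apply: filterS => x /= + _ => /(_ I); apply: IH => //.
- exact: measurable_cons_section.
- exact: measurable_cons_section.
- by move=> v; exact: fg.
Qed.

End iter_lebesgue_theory.

(** * Linear change of variables *)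
Section linear_change_of_variables.
Context {R : realType}.
Local Notation mu := (@lebesgue_measure R).
Local Open Scope ereal_scope.

Definition scales_lebesgue p (M : 'M[R]_p) : Prop :=
  forall f : 'cV[R]_p -> \bar R, measurable_fun setT f -> (forall v, 0 <= f v) ->
    iter_lebesgue (fun v => f (M *m v)%R) = (`|\det M|^-1)%:E * iter_lebesgue f.

Lemma scales_lebesgue_mul p (A B : 'M[R]_p) :
  scales_lebesgue A -> scales_lebesgue B -> scales_lebesgue (A *m B)%R.
Proof.
move=> sA sB f mf f0; under eq_fun do rewrite -mulmxA.
rewrite (sB (fun v => f (A *m v)%R))//.
  by rewrite sA// muleA -EFinM det_mulmx normrM invfM mulrC.
exact: measurableT_comp mf (measurable_mulmx_l A).
Qed.

Lemma mul_block_cons_cv p (a : R) (b : 'rV[R]_p) (c : 'cV[R]_p) (D : 'M[R]_p) x v :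
  ((block_mx a%:M b c D : 'M[R]_p.+1) *m cons_cv x v =
   cons_cv (a * x + (b *m v) 0 0) (x *: c + D *m v))%R.
Proof.
have -> : (x *: c = c *m x%:M)%R by rewrite mul_mx_scalar.
rewrite /cons_cv (@mul_block_col _ 1 p 1 p) -scalar_mxM.
by rewrite [(b *m v)%R in LHS]mx11_scalar -raddfD.
Qed.

(** For a fixed first coordinate x, the shear translates the others by x *: c.
    *)
Lemma scales_lebesgue_lshear p (c : 'cV[R]_p) :
  scales_lebesgue (block_mx 1%:M 0%R c 1%:M : 'M[R]_p.+1).
Proof.
move=> f mf f0; rewrite (@det_lblock _ 1 p) !det1 mul1r normr1 invr1 mul1e /=.
apply: eq_integral => x _; under eq_fun do
  rewrite mul_block_cons_cv mul0mx mul1mx mxE addr0 mul1r addrC.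
rewrite (iter_lebesgue_translate _ (f := fun v => f (cons_cv x v)))//.
exact: measurable_cons_section.
Qed.

(** For fixed last coordinates, the shear translates the first one; integrating
    it first is allowed by Tonelli's theorem. *)
Lemma scales_lebesgue_ushear p (b : 'rV[R]_p) :
  scales_lebesgue (block_mx 1%:M b 0%R 1%:M : 'M[R]_p.+1).
Proof.
move=> f mf f0; rewrite (@det_ublock _ 1 p) !det1 mul1r normr1 invr1 mul1e /=.
have mf' := measurable_cons_uncurry mf.
rewrite [RHS](iter_lebesgue_swap mf')//.
under [LHS]eq_integral do under eq_fun do
  rewrite mul_block_cons_cv mul1mx scaler0 add0r.
rewrite (iter_lebesgue_swap
  (f := fun z => f (cons_cv (1 * z.1 + (b *m z.2) 0 0)%R z.2)))//=; last first.
  apply: (measurableT_comp mf); apply: measurable_cons_cv => //.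
  apply: measurable_funD; first exact: measurable_funM.
  exact: measurableT_comp (measurable_mx_entry 0%R 0%R)
    (measurableT_comp (measurable_mulmx_l b) measurable_snd).
congr iter_lebesgue; apply/funext => v.
rewrite (ge0_integral_affine _ (f := fun x => f (cons_cv x v)))//.
  by rewrite normr1 invr1 mul1e.
by apply: (measurableT_comp mf); exact: measurable_cons_cv.
Qed.

(** The factors `|a|^-1 and `|\det D|^-1 come from integrating separately over
    the first coordinate and over the others. *)
Lemma scales_lebesgue_diag p (a : R) (D : 'M[R]_p) : a != 0%R ->
  scales_lebesgue D ->
  scales_lebesgue (block_mx (a%:M : 'M[R]_1) 0%R 0%R D : 'M[R]_p.+1).
Proof.
move=> a0 sD f mf f0; rewrite (@det_ublock _ 1 p) det_scalar1 normrM invfM EFinM/=.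
pose F x := iter_lebesgue (fun v => f (cons_cv x v)).
have mF : measurable_fun setT F by exact: measurable_iter_lebesgue_cons.
have F0 x : 0 <= F x by exact: iter_lebesgue_ge0.
rewrite -/(F _) -muleA muleCA -(ge0_integral_affine 0 a0 mF F0).
rewrite -ge0_integralZl//; last first.
  by apply: (measurableT_comp mF); exact: measurable_affine.
apply: eq_integral => x _; under eq_fun do
  rewrite mul_block_cons_cv mul0mx scaler0 add0r mxE.
rewrite (sD (fun v => f (cons_cv (a * x + 0)%R v)))//.
exact: measurable_cons_section.
Qed.

Lemma block_LDU p (a : R) (b : 'rV[R]_p) (c : 'cV[R]_p) (D : 'M[R]_p) : a != 0%R ->
  (block_mx a%:M b c D =
   block_mx 1%:M 0 (a^-1 *: c) 1%:M *m
   block_mx a%:M 0 0 (D - a^-1 *: (c *m b)) *m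
   block_mx 1%:M (a^-1 *: b) 0 1%:M)%R.
Proof.
move=> a0; rewrite !mulmx_block.
rewrite !(mul0mx, mulmx0, addr0, add0r, mul1mx, mulmx1).
rewrite !(mul_scalar_mx, mul_mx_scalar) !scalerA !divff// !scale1r.
by rewrite -scalemxAr addrCA subrr addr0.
Qed.

(** Induction on p: an invertible matrix with nonzero upper left entry factors
    by block elimination into two shears and a block diagonal matrix, and any
    invertible matrix gets such an entry by adding one of its rows to the first.
    *)
Theorem iter_lebesgue_linear p (M : 'M[R]_p) : M \in unitmx -> scales_lebesgue M.
Proof.
elim: p M => [|p IH] M Mu.
  move=> f _ _ /=; rewrite det_mx00 normr1 invr1 mul1e; congr f.
  by apply/matrixP => -[].
have pivot (N : 'M[R]_p.+1) :
    N \in unitmx -> N 0%R 0%R != 0%R -> scales_lebesgue N.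
  move=> Nu a0; have NE := esym (@submxK _ 1 p 1 p N).
  rewrite [ulsubmx _]mx11_scalar in NE.
  have aE : @ulsubmx _ 1 p 1 p N 0%R 0%R = N 0%R 0%R.
    by rewrite !mxE; congr (N _ _); exact: val_inj.
  rewrite aE (block_LDU _ _ _ a0) in NE.
  move: Nu; rewrite NE => Nu; apply: scales_lebesgue_mul;
    last exact: scales_lebesgue_ushear.
  apply: scales_lebesgue_mul; first exact: scales_lebesgue_lshear.
  apply: scales_lebesgue_diag => //; apply: IH; move: Nu.
  rewrite !unitmxE !det_mulmx (@det_lblock _ 1 p) !(@det_ublock _ 1 p) !det1.
  by rewrite !mul1r mulr1 det_scalar1 unitfE mulf_eq0 (negbTE a0) unitfE.
have [M00|] := eqVneq (M 0 0)%R 0%R; last exact: pivot.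
(* The first column is not zero, as the inverse of M maps it to a unit vector. *)
have [i Mi0] : exists i : 'I_p, M (lift ord0 i) 0%R != 0%R.
  apply/not_existsP => Mi0; have := mulVmx Mu => /matrixP/(_ 0%R 0%R)/eqP.
  rewrite !mxE big1 ?eqxx ?(eq_sym 0%R) ?oner_eq0// => k _.
  case: (unliftP ord0 k) => [l|] ->; last by rewrite M00 mulr0.
  by move/negP: (Mi0 l); rewrite negbK => /eqP ->; rewrite mulr0.
(* U 1 adds row i + 1 to row 0, and U (-1) undoes it. *)
pose U (c : R) : 'M[R]_p.+1 :=
  block_mx (1%:M : 'M[R]_1) (c *: delta_mx 0 i)%R 0%R 1%:M.
have UK : (M = U (-1) *m (U 1 *m M))%R.
  rewrite mulmxA /U (@mulmx_block _ 1 p 1 p 1 p).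
  rewrite !(mul1mx, mulmx1, mulmx0, mul0mx, addr0, add0r) scaleN1r scale1r subrr.
  by rewrite -(@scalar_mx_block _ 1 p) mul1mx.
have Uu c : U c \in unitmx by rewrite unitmxE (@det_ublock _ 1 p) !det1 mulr1 unitr1.
rewrite UK; apply: scales_lebesgue_mul; first exact: scales_lebesgue_ushear.
apply: pivot; first by rewrite unitmx_mul Uu.
have -> : ((U 1 *m M) 0 0 = (U 1 *m col 0 M) 0 0)%R.
  by rewrite !mxE; apply: eq_bigr => k _; rewrite !mxE.
rewrite (cons_cv_eta (col 0%R M)) mul_block_cons_cv cons_cv0 mxE M00 mulr0 add0r.
by rewrite scale1r -rowE !mxE.
Qed.

End linear_change_of_variables.

(** * Integrals against product laws *)
Section product_law_integrals.
Context {R : realType}.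
Local Open Scope ereal_scope.

Lemma ge0_integral_product_law_nil d (T : measurableType d)
    (P : 'I_0 -> probability T R) (f : 0.-tuple T -> \bar R) :
  measurable_fun setT f -> \int[product_law P]_z f z = f [tuple].
Proof. by move=> mf; rewrite integral_dirac// diracT mul1e. Qed.

Lemma ge0_integral_product_law_cons d (T : measurableType d) n
    (P : 'I_n.+1 -> probability T R) (f : n.+1.-tuple T -> \bar R) :
  measurable_fun setT f -> (forall z, 0 <= f z) ->
  \int[product_law P]_z f z =
  \int[P ord0]_x \int[product_law (fun i => P (lift ord0 i))]_z
    f (tuple_cons (x, z)).
Proof.
move=> mf f0; rewrite ge0_integral_distribution// fubini_tonelli1//.
- exact: measurableT_comp mf (@measurable_tuple_cons _ T n).
- by move=> z /=.
Qed.

Lemma measurable_tuple_cons_comp d (T : measurableType d) n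
    (f : n.+1.-tuple T -> \bar R) : measurable_fun setT f ->
  measurable_fun setT (fun z : T * n.-tuple T => f (tuple_cons z)).
Proof. by move=> mf; exact: measurableT_comp mf (@measurable_tuple_cons _ T n). Qed.

Lemma measurable_integral_product_law_cons d (T : measurableType d) n
    (P : 'I_n -> probability T R) (f : n.+1.-tuple T -> \bar R) :
  measurable_fun setT f -> (forall z, 0 <= f z) ->
  measurable_fun setT (fun x => \int[product_law P]_z f (tuple_cons (x, z))).
Proof.
move=> /measurable_tuple_cons_comp mf f0.
by apply: (@measurable_fun_fubini_tonelli_F _ _ _ _ _ (product_law P) _ mf) => z.
Qed.

Lemma measurable_map_tuple d d' (T : measurableType d) (T' : measurableType d')
    n (phi : T -> T') : measurable_fun setT phi ->
  measurable_fun setT (fun z : n.-tuple T => map_tuple phi z).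
Proof.
move=> mphi; apply/measurable_fun_tnthP => i.
rewrite (_ : _ \o _ = phi \o (fun z : n.-tuple T => tnth z i)); last first.
  by apply/funext => z /=; rewrite tnth_map.
exact: measurableT_comp mphi (measurable_tnth i).
Qed.

Lemma ge0_integral_product_law_map d d' (T : measurableType d)
    (T' : measurableType d') n (P : 'I_n -> probability T R)
    (Q : 'I_n -> probability T' R) (phi : T -> T') :
  measurable_fun setT phi ->
  (forall i (h : T' -> \bar R), measurable_fun setT h -> (forall x, 0 <= h x) ->
     \int[Q i]_y h y = \int[P i]_x h (phi x)) ->
  forall f : n.-tuple T' -> \bar R, measurable_fun setT f -> (forall z, 0 <= f z) ->
  \int[product_law Q]_z f z = \int[product_law P]_z f (map_tuple phi z).
Proof.
move=> mphi; elim: n P Q => [|n IH] P Q QP f mf f0.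
  rewrite !ge0_integral_product_law_nil//; last first.
    exact: measurableT_comp mf (measurable_map_tuple mphi).
  by congr f; apply: val_inj.
rewrite !ge0_integral_product_law_cons//; last first.
  exact: measurableT_comp mf (measurable_map_tuple mphi).
rewrite QP; last 2 first.
- exact: measurable_integral_product_law_cons.
- by move=> x; exact: integral_ge0.
apply: eq_integral => x _.
rewrite (IH (fun i => P (lift ord0 i)) _ _ (fun z => f (tuple_cons (phi x, z))))//.
- by apply: eq_integral => z _; congr f; exact: val_inj.
- by move=> i h mh h0; exact: QP.
- exact: measurableT_comp (measurable_tuple_cons_comp mf) (measurable_pair1 _).
Qed.

(** Absolute continuity passes from the marginals to the product law, here in
    terms of nonnegative functions with integral zero. *)
Lemma integral_product_law_null d (T : measurableType d) n
    (P Q : 'I_n -> probability T R) :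
  (forall i (h : T -> \bar R), measurable_fun setT h -> (forall x, 0 <= h x) ->
     \int[P i]_x h x = 0 -> \int[Q i]_x h x = 0) ->
  forall f : n.-tuple T -> \bar R, measurable_fun setT f -> (forall z, 0 <= f z) ->
  \int[product_law P]_z f z = 0 -> \int[product_law Q]_z f z = 0.
Proof.
elim: n P Q => [|n IH] P Q PQ f mf f0.
  by rewrite !ge0_integral_product_law_nil.
rewrite !ge0_integral_product_law_cons//.
move=> /PQ PF; have {}PF := PF (measurable_integral_product_law_cons _ mf f0)
  (fun x => integral_ge0 _ (fun z _ => f0 _)).
pose F (L : 'I_n -> probability T R) x := \int[product_law L]_z f (tuple_cons (x, z)).
have F0 L x : 0 <= F L x by exact: integral_ge0.
have mF L : measurable_fun setT (F L) by exact: measurable_integral_product_law_cons.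
have FE L : \int[Q ord0]_x F L x = \int[Q ord0]_x `|F L x|.
  by apply: eq_integral => x _; rewrite gee0_abs.
rewrite -/(F _ _) FE; apply/ae_eq_integral_abs => //.
move: PF; rewrite -/(F _ _) FE => /ae_eq_integral_abs - /(_ measurableT (mF _)).
apply: filterS => x /= + _ => /(_ I); apply: IH => //.
- by move=> i h mh h0; exact: PQ.
- exact: measurableT_comp (measurable_tuple_cons_comp mf) (measurable_pair1 _).
Qed.

End product_law_integrals.

(** * The standard normal law *)
Section standard_gaussian.
Context {R : realType}.
Local Notation mu := (@lebesgue_measure R).
Local Open Scope ereal_scope.

Definition std_density p (v : 'cV[R]_p) : R :=
  \prod_(i < p) normal_pdf 0 1 (v i 0%R).

Lemma std_density_cons p x (v : 'cV[R]_p) :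
  std_density (cons_cv x v) = (normal_pdf 0 1 x * std_density v)%R.
Proof.
rewrite /std_density big_ord_recl cons_cv0; congr (_ * _)%R.
by apply: eq_bigr => i _; rewrite cons_cvS.
Qed.

Lemma std_density_gt0 p (v : 'cV[R]_p) : (0 < std_density v)%R.
Proof.
apply: prodr_gt0 => i _; rewrite normal_pdfE ?oner_neq0//.
by rewrite mulr_gt0 ?expR_gt0// normal_peak_gt0 ?oner_neq0.
Qed.

Lemma measurable_std_density p : measurable_fun setT (@std_density p).
Proof.
apply: measurable_prod => i _.
exact: measurableT_comp (measurable_normal_pdf _ _) (measurable_mx_entry i 0%R).
Qed.

Lemma std_densityE p (v : 'cV[R]_p) :
  std_density v = (normal_peak 1 ^+ p * expR (- ((v^T *m v) 0 0) / 2))%R.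
Proof.
rewrite /std_density; under eq_bigr do rewrite normal_pdfE ?oner_neq0//.
rewrite big_split/= prodr_const card_ord; congr (_ * _)%R.
rewrite -expR_sum; congr expR; rewrite mxE -sumrN mulr_suml.
by apply: eq_bigr => i _; rewrite subr0 expr1n mxE -expr2.
Qed.

Lemma std_density_orthogonal p (O : 'M[R]_p) (v : 'cV[R]_p) :
  (O^T *m O = 1%:M)%R -> std_density (O *m v)%R = std_density v.
Proof.
move=> OO; rewrite !std_densityE trmx_mul mulmxA -[(_ *m _ *m O)%R]mulmxA OO.
by rewrite mulmx1.
Qed.

Definition std_normal p := product_law (fun _ : 'I_p => normal_law (0 : R) 1).

Definition cv_of_tuple p (z : p.-tuple R) : 'cV[R]_p := \col_i tnth z i.

Lemma measurable_cv_of_tuple p : measurable_fun setT (@cv_of_tuple p).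
Proof.
apply: measurable_fun_mx => i j; under eq_fun do rewrite mxE.
exact: measurable_tnth.
Qed.

Lemma cv_of_tuple_cons p (x : R) (z : p.-tuple R) :
  cv_of_tuple (tuple_cons (x, z)) = cons_cv x (cv_of_tuple z).
Proof.
apply/colP => i; rewrite mxE; case: (unliftP ord0 i) => [k|] ->.
  by rewrite cons_cvS mxE !(tnth_nth 0%R).
by rewrite cons_cv0 (tnth_nth 0%R).
Qed.

Lemma ge0_integral_std_normal p (f : 'cV[R]_p -> \bar R) :
  measurable_fun setT f -> (forall v, 0 <= f v) ->
  \int[std_normal p]_z f (cv_of_tuple z) =
  iter_lebesgue (fun v => (std_density v)%:E * f v).
Proof.
elim: p f => [|p IH] f mf f0.
  rewrite ge0_integral_product_law_nil/=; last first.
    exact: measurableT_comp mf (@measurable_cv_of_tuple 0).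
  rewrite /std_density big_ord0 mul1e; congr f.
  by apply/matrixP => -[].
rewrite ge0_integral_product_law_cons//; last first.
  exact: measurableT_comp mf (@measurable_cv_of_tuple p.+1).
transitivity (\int[normal_law 0 1]_x
    iter_lebesgue (fun v => (std_density v)%:E * f (cons_cv x v))).
  apply: eq_integral => x _; rewrite -IH//; last exact: measurable_cons_section.
  by apply: eq_integral => z _; rewrite cv_of_tuple_cons.
have md := @measurable_std_density p.
rewrite ge0_integral_normal_law; last 2 first.
- apply: (measurable_iter_lebesgue
    (f := fun z => (std_density z.2)%:E * f (cons_cv z.1 z.2))).
    apply: emeasurable_funM; last exact: measurable_cons_uncurry.
    apply/measurable_EFinP; exact: measurableT_comp md measurable_snd.
  by move=> z; rewrite mule_ge0// lee_fin ltW// std_density_gt0.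
- move=> x; apply: iter_lebesgue_ge0 => v.
  by rewrite mule_ge0// lee_fin ltW// std_density_gt0.
apply: eq_integral => x _; rewrite -iter_lebesgueZ.
- congr iter_lebesgue; apply/funext => v.
  by rewrite std_density_cons EFinM muleA.
- exact: normal_pdf_ge0.
- apply: emeasurable_funM; last exact: measurable_cons_section.
  exact/measurable_EFinP.
- by move=> v; rewrite mule_ge0// lee_fin ltW// std_density_gt0.
Qed.

(** The density and Lebesgue measure are both invariant under O, the latter
    because `|\det O| = 1. *)
Lemma std_normal_orthogonal p (O : 'M[R]_p) (f : 'cV[R]_p -> \bar R) :
  (O^T *m O = 1%:M)%R -> measurable_fun setT f -> (forall v, 0 <= f v) ->
  \int[std_normal p]_z f (O *m cv_of_tuple z)%R =
  \int[std_normal p]_z f (cv_of_tuple z).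
Proof.
move=> OO mf f0.
have Ou : O \in unitmx by have [] := mulmx1_unit OO.
have detO : (`|\det O| = 1)%R.
  have /eqP : (\det O ^+ 2 = 1)%R by rewrite expr2 -{1}det_tr -det_mulmx OO det1.
  by rewrite sqrf_eq1 => /orP[]/eqP ->; rewrite ?normrN normr1.
rewrite (ge0_integral_std_normal (f := fun v => f (O *m v)%R))//; last first.
  exact: measurableT_comp mf (measurable_mulmx_l O).
rewrite ge0_integral_std_normal//.
pose g v := (std_density v)%:E * f v.
transitivity (iter_lebesgue (fun v => g (O *m v)%R)).
  by congr iter_lebesgue; apply/funext => v; rewrite /g std_density_orthogonal.
rewrite iter_lebesgue_linear//; first by rewrite detO invr1 mul1e.
- apply: emeasurable_funM => //; apply/measurable_EFinP.
  exact: measurable_std_density.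
- by move=> v; rewrite mule_ge0// lee_fin ltW// std_density_gt0.
Qed.

(** The law of M Z is absolutely continuous with respect to that of Z: both have
    the null sets of Lebesgue measure, which M preserves. *)
Lemma std_normal_null_linear p (M : 'M[R]_p) (f : 'cV[R]_p -> \bar R) :
  M \in unitmx -> measurable_fun setT f -> (forall v, 0 <= f v) ->
  \int[std_normal p]_z f (cv_of_tuple z) = 0 ->
  \int[std_normal p]_z f (M *m cv_of_tuple z)%R = 0.
Proof.
move=> Mu mf f0.
have mfM : measurable_fun setT (fun v => f (M *m v)%R).
  exact: measurableT_comp mf (measurable_mulmx_l M).
have md : measurable_fun setT (fun v => (@std_density p v)%:E).
  by apply/measurable_EFinP; exact: measurable_std_density.
have d0 (v : 'cV[R]_p) : 0 <= (std_density v)%:E.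
  by rewrite lee_fin ltW// std_density_gt0.
rewrite ge0_integral_std_normal// (ge0_integral_std_normal mfM)// => If.
apply: (iter_lebesgue_null mfM) => //.
- exact: emeasurable_funM.
- by move=> v; rewrite mule_ge0.
- by move=> v ->; rewrite mule0.
rewrite (iter_lebesgue_linear Mu mf f0) [X in _ * X](_ : _ = 0) ?mule0//.
apply: iter_lebesgue_null If => //.
- exact: emeasurable_funM.
- by move=> v; rewrite mule_ge0.
move=> v /eqP; rewrite mule_eq0 => /orP[|/eqP//].
by rewrite eqe gt_eqF// std_density_gt0.
Qed.

End standard_gaussian.

(** * Square roots of positive semidefinite matrices *)
Lemma poly_interpolation (F : fieldType) (g : F -> F) (s : seq F) :
  exists r : {poly F}, {in s, forall x, r.[x] = g x}.
Proof.
elim: s => [|x s [r rE]]; first by exists 0.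
have [xs|xs] := boolP (x \in s).
  by exists r => y; rewrite inE => /predU1P[->|]; exact: rE.
pose q := \prod_(y <- s) ('X - y%:P).
have qx0 : q.[x] != 0 by rewrite -rootE root_prod_XsubC.
exists (r + ((g x - r.[x]) / q.[x]) *: q) => y; rewrite !inE hornerD hornerZ.
have [-> _|_ /= ys] := eqVneq y x; first by rewrite divfK// addrC subrK.
by rewrite (rootP _ : q.[y] = 0) ?root_prod_XsubC// mulr0 addr0 rE.
Qed.

Lemma trmx_horner_mx (R : comNzRingType) n (A : 'M[R]_n.+1) (q : {poly R}) :
  (horner_mx A q)^T = horner_mx A^T q.
Proof.
elim/poly_ind: q => [|q c IH]; first by rewrite !rmorph0 trmx0.
rewrite !rmorphD !rmorphM/= !horner_mx_X !horner_mx_C linearD/= tr_scalar_mx.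
by rewrite -!mulmxE trmx_mul IH; congr (_ + _); rewrite -comm_horner_mx.
Qed.

Section square_root.
Context {R : realType}.

Lemma dot_self_ge0 p (v : 'cV[R]_p) : 0 <= (v^T *m v) 0 0.
Proof. by rewrite mxE sumr_ge0// => i _; rewrite mxE -expr2 sqr_ge0. Qed.

Lemma dot_self_gt0 p (v : 'cV[R]_p) : v != 0 -> 0 < (v^T *m v) 0 0.
Proof.
apply: contraNlt; rewrite le_eqVlt ltNge dot_self_ge0 orbF mxE.
under eq_bigr do rewrite mxE -expr2.
rewrite psumr_eq0 => [/allP v0|i _]; last exact: sqr_ge0.
apply/eqP/colP => i; rewrite mxE; apply/eqP; rewrite -sqrf_eq0.
by apply: v0; rewrite mem_index_enum.
Qed.

Lemma eigenvalue_possemidef_ge0 p (M : 'M[R]_p) (a : R) :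
  possemidefmx M -> eigenvalue M a -> 0 <= a.
Proof.
move=> [Msym Mpos] /eigenvalueP[u uM u0].
have u0' : u^T != 0 by rewrite trmx_eq0.
have := Mpos u^T; rewrite trmxK uM -scalemxAl mxE -[u in u *m _]trmxK.
by rewrite pmulr_lge0// dot_self_gt0.
Qed.

(** The spectral theorem for Hermitian matrices. The eigenvectors are complex,
    which is harmless for polynomial identities satisfied by M. *)
Lemma symmetric_diagonalization p (M : 'M[R]_p) : M^T = M ->
  exists (P : 'M[R[i]]_p) (d : 'rV[R]_p), P \in unitmx /\
    map_mx (real_complex R) M =
    invmx P *m diag_mx (map_mx (real_complex R) d) *m P.
Proof.
move=> Msym; pose A := map_mx (real_complex R) M.
have Aherm : A \is hermsymmx.
  apply/is_hermitianmxP; rewrite expr0 scale1r; apply/matrixP => i j.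
  by rewrite !mxE/= -[in LHS]Msym mxE; apply/esym/CrealP/complex_realP; eexists.
have /orthomx_spectralP AE := hermitian_normalmx Aherm.
exists (spectralmx A), (map_mx (@complex.Re R) (spectral_diag A)).
split; first exact: spectral_unit.
rewrite [LHS]AE; suff -> : map_mx (real_complex R) (map_mx (@complex.Re R)
  (spectral_diag A)) = spectral_diag A by [].
apply/rowP => i; rewrite !mxE; apply: RRe_real.
by have /mxOverP := hermitian_spectral_diag_real Aherm; apply.
Qed.

(** Let r be a real polynomial with r(a) = a^(1/4) at each eigenvalue a >= 0
    of M. Then S = r(M)^2 is real and symmetric as a polynomial in M, it is
    positive semidefinite as the square of a symmetric matrix, and S^2 = r(M)^4
    equals M, as seen after diagonalizing over the complex numbers. *)
Lemma exists_sqrtmx p (M : 'M[R]_p) : possemidefmx M ->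
  exists S, possemidefmx S /\ S *m S = M.
Proof.
case: p M => [|p] M Mpsd; first by exists M; split => //; apply/matrixP => -[].
 have [Msym _] := Mpsd.
have [P [d [Pu ME]]] := symmetric_diagonalization Msym.
set f := real_complex R in ME.
have d_ge0 i : 0 <= d 0 i.
  apply: (eigenvalue_possemidef_ge0 Mpsd).
  rewrite eigenvalue_root_char -(fmorph_root f) map_char_poly -eigenvalue_root_char.
  apply/eigenvalueP; exists (row i P).
    rewrite -row_mul ME !mulmxA mulmxV// mul1mx row_mul.
    by rewrite row_diag_mx -scalemxAl -rowE mxE.
  apply/eqP => /(congr1 (mulmx^~ (invmx P))).
  rewrite -row_mul mulmxV// mul0mx row1 => /rowP/(_ i)/eqP.
  by rewrite !mxE !eqxx oner_eq0.
have [r rE] := poly_interpolation (fun x => Num.sqrt (Num.sqrt x))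
  [seq d 0 i | i <- enum 'I_p.+1].
have r4 i : (r ^+ 4).[d 0 i] = d 0 i.
  rewrite horner_exp rE; last by rewrite map_f// mem_enum.
  by rewrite (exprM _ 2 2) !sqr_sqrtr// sqrtr_ge0.
have Hsym : (horner_mx M r)^T = horner_mx M r by rewrite trmx_horner_mx Msym.
exists (horner_mx M (r ^+ 2)); split.
  split; first by rewrite trmx_horner_mx Msym.
  move=> v; rewrite rmorphXn/= expr2 -mulmxE mulmxA -mulmxA.
  by rewrite -[X in v^T *m X]Hsym -trmx_mul dot_self_ge0.
rewrite mulmxE -rmorphM/=; apply: (@map_mx_inj _ _ f).
rewrite map_horner_mx ME (horner_mx_uconjC _ _ Pu) horner_mx_diag.
suff -> : map_mx (horner (map_poly f (r ^+ 2 * r ^+ 2))) (map_mx f d) = map_mx f d.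
  by [].
by apply/rowP => i; rewrite !mxE horner_map/= -exprD r4.
Qed.
End square_root.

(** * Positive definite matrices *)
Section positive_definite.
Context {R : realType} {p : nat}.
Implicit Types M S : 'M[R]_p.

Lemma posdefmx_possemidef M : posdefmx M -> possemidefmx M.
Proof.
move=> [Msym Mpos]; split => // v; have [->|v0] := eqVneq v 0.
  by rewrite mulmx0 mxE.
exact/ltW/Mpos.
Qed.

Lemma posdefmx_unit M : posdefmx M -> M \in unitmx.
Proof.
move=> [Msym Mpos]; rewrite unitmxE unitfE; apply/negP => /eqP/eqP/det0P[u u0 uM].
have := Mpos u^T; rewrite trmx_eq0 u0 trmxK uM mul0mx mxE ltxx.
by move=> /(_ isT).
Qed.

Lemma posdefmx_congr M S : posdefmx M -> S \in unitmx -> posdefmx (S^T *m M *m S).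
Proof.
move=> [Msym Mpos] Su; split; first by rewrite !trmx_mul trmxK Msym mulmxA.
move=> v v0; rewrite !mulmxA -trmx_mul -mulmxA; apply: Mpos.
apply: contra_neq v0 => Sv0; by rewrite -[v](mulKmx Su) Sv0 mulmx0.
Qed.

Lemma posdefmx_inv M : posdefmx M -> posdefmx (invmx M).
Proof.
move=> Mpd; have Mu := posdefmx_unit Mpd; have [Msym _] := Mpd.
have := posdefmx_congr Mpd (S := invmx M).
by rewrite unitmx_inv trmx_inv Msym mulVmx// mul1mx; apply.
Qed.

Lemma posdefmx1 : posdefmx (1%:M : 'M[R]_p).
Proof.
by split => [|v v0]; rewrite ?trmx1// mulmx1 dot_self_gt0.
Qed.

Lemma sqrtmxP M : possemidefmx M ->
  possemidefmx (sqrtmx M) /\ sqrtmx M *m sqrtmx M = M.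
Proof.
move=> /exists_sqrtmx[S SP]; rewrite /sqrtmx.
by case: xgetP => [T _ //|/(_ S)].
Qed.

Lemma sqrtmx_sym M : posdefmx M -> (sqrtmx M)^T = sqrtmx M.
Proof. by move=> /posdefmx_possemidef/sqrtmxP[[]]. Qed.

Lemma sqrtmx_sqr M : posdefmx M -> sqrtmx M *m sqrtmx M = M.
Proof. by move=> /posdefmx_possemidef/sqrtmxP[]. Qed.

Lemma sqrtmx_unit M : posdefmx M -> sqrtmx M \in unitmx.
Proof.
by move=> Mpd; have := posdefmx_unit Mpd; rewrite -{1}(sqrtmx_sqr Mpd) unitmx_mul andbb.
Qed.

Lemma invsqrtmx_sym M : posdefmx M -> (invsqrtmx M)^T = invsqrtmx M.
Proof. by move=> Mpd; rewrite /invsqrtmx trmx_inv sqrtmx_sym. Qed.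

Lemma invsqrtmx_unit M : posdefmx M -> invsqrtmx M \in unitmx.
Proof. by move=> Mpd; rewrite unitmx_inv sqrtmx_unit. Qed.

Lemma invsqrtmx_sqr M : posdefmx M -> invsqrtmx M *m invsqrtmx M = invmx M.
Proof.
move=> Mpd; have Mu := posdefmx_unit Mpd; have Su := sqrtmx_unit Mpd.
suff E : M *m (invsqrtmx M *m invsqrtmx M) = 1%:M.
  by rewrite -[LHS](mulKmx Mu) E mulmx1.
by rewrite -[X in X *m _](sqrtmx_sqr Mpd) /invsqrtmx mulmxA mulmxK// mulmxV.
Qed.

Lemma invsqrtmx_whitens M : posdefmx M -> invsqrtmx M *m M *m invsqrtmx M = 1%:M.
Proof.
move=> Mpd; have Su := sqrtmx_unit Mpd.
by rewrite -[X in _ *m X *m _](sqrtmx_sqr Mpd) /invsqrtmx mulKmx// mulmxV.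
Qed.

(** I + A + A^2 = ((I + 2 A)^2 + 3 I) / 4 for every A. *)
Lemma posdefmx_precision_omega n (omega : R) (H : 'M[R]_p) :
  H^T = H -> posdefmx (precision_omega n omega H).
Proof.
move=> Hsym; rewrite /precision_omega; set A := _ *: H.
have Asym : A^T = A by rewrite linearZ/= Hsym.
move: A Asym => {Hsym H} A Asym; split;
  first by rewrite !linearD/= trmx1 trmx_mul Asym.
move=> v v0; pose u := v + 2 *: (A *m v).
suff -> : (v^T *m (1%:M + A + A *m A) *m v) 0 0 =
    4^-1 * ((u^T *m u) 0 0 + 3 * (v^T *m v) 0 0).
  by rewrite mulr_gt0// ltr_wpDl ?dot_self_ge0// mulr_gt0// dot_self_gt0.
have uE : u^T = v^T + 2 *: (v^T *m A) by rewrite linearD linearZ/= trmx_mul Asym.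
rewrite uE /u !(mulmxDl, mulmxDr) mulmx1 -!scalemxAl -!scalemxAr !mulmxA.
have D (X Y : 'M[R]_1) : (X + Y) 0 0 = X 0 0 + Y 0 0 by rewrite mxE.
have Z k (X : 'M[R]_1) : (k *: X) 0 0 = k * X 0 0 by rewrite mxE.
by rewrite !(D, Z); field.
Qed.

End positive_definite.

(** * Whitening Gaussian samples *)
Section whitening.
Context {R : realType} {p : nat}.
Local Open Scope ereal_scope.
Implicit Types Sigma A V W : 'M[R]_p.

Lemma ge0_integral_gaussian Sigma (f : 'cV[R]_p -> \bar R) :
  measurable_fun setT f -> (forall v, 0 <= f v) ->
  \int[gaussian Sigma]_v f v =
  \int[std_normal p]_z f (sqrtmx Sigma *m cv_of_tuple z)%R.
Proof. by move=> mf f0; rewrite ge0_integral_distribution. Qed.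

(** A V^(1/2) and W^(1/2) have the same product with their transpose, hence
    differ by an orthogonal factor O on the right, which does not change the
    law. *)
Lemma ge0_integral_gaussian_congr A V W (f : 'cV[R]_p -> \bar R) :
  posdefmx V -> posdefmx W -> (A *m V *m A^T = W)%R ->
  measurable_fun setT f -> (forall v, 0 <= f v) ->
  \int[gaussian W]_v f v = \int[gaussian V]_v f (A *m v)%R.
Proof.
move=> Vpd Wpd AVA mf f0.
have mfA (M : 'M[R]_p) : measurable_fun setT (fun v => f (M *m v)%R).
  exact: measurableT_comp mf (measurable_mulmx_l M).
rewrite !ge0_integral_gaussian//.
have Wu := sqrtmx_unit Wpd.
pose O := (invmx (sqrtmx W) *m (A *m sqrtmx V))%R.
have OO : (O^T *m O = 1%:M)%R.
  apply: mulmx1C; rewrite /O !trmx_mul trmx_inv !sqrtmx_sym//.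
  rewrite !mulmxA -[(_ *m sqrtmx V *m sqrtmx V)%R]mulmxA sqrtmx_sqr//.
  rewrite -[(_ *m A *m V)%R]mulmxA -[(_ *m _ *m A^T)%R]mulmxA AVA.
  by rewrite -[in X in (_ *m X *m _)%R](sqrtmx_sqr Wpd) mulKmx// mulmxV.
rewrite -(std_normal_orthogonal OO (mfA (sqrtmx W)))//.
by apply: eq_integral => z _; rewrite /O !mulmxA mulmxV// mul1mx.
Qed.

Lemma ge0_integral_whiten n Sigma0 V W (f : n.-tuple 'cV[R]_p -> \bar R) :
  posdefmx Sigma0 -> posdefmx V -> posdefmx W ->
  (invsqrtmx Sigma0 *m V *m invsqrtmx Sigma0 = W)%R ->
  measurable_fun setT f -> (forall x, 0 <= f x) ->
  \int[gaussian_sample n W]_x f x =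
  \int[gaussian_sample n V]_x f (whiten Sigma0 x).
Proof.
move=> S0pd Vpd Wpd VW mf f0.
rewrite (ge0_integral_product_law_map (phi := mulmx (invsqrtmx Sigma0))
  (P := fun=> gaussian V))//.
- apply: eq_integral => x _; congr f; apply: eq_from_tnth => t.
  by rewrite tnth_map tnth_mktuple.
- exact: measurable_mulmx_l.
- move=> _ h mh h0; apply: ge0_integral_gaussian_congr => //.
  by rewrite invsqrtmx_sym.
Qed.

Lemma gaussian_sample_whiten n Sigma0 V W (B : set (n.-tuple 'cV[R]_p)) :
  posdefmx Sigma0 -> posdefmx V -> posdefmx W ->
  (invsqrtmx Sigma0 *m V *m invsqrtmx Sigma0 = W)%R -> measurable B ->
  gaussian_sample n V (whiten Sigma0 @^-1` B) = gaussian_sample n W B.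
Proof.
move=> S0pd Vpd Wpd VW mB.
have mw : measurable (whiten Sigma0 @^-1` B).
  by rewrite -[X in measurable X]setTI; exact: measurable_whiten.
transitivity (\int[gaussian_sample n V]_x (\1_(whiten Sigma0 @^-1` B) x)%:E).
  by rewrite integral_indic// setIT.
transitivity (\int[gaussian_sample n W]_x (\1_B x)%:E); last first.
  by rewrite integral_indic// setIT.
rewrite (ge0_integral_whiten S0pd Vpd Wpd VW)//.
exact/measurable_EFinP/measurable_indic.
Qed.

(** Nondegenerate Gaussian laws have the same null sets: with M = Sigma0^(-1/2)
    Sigma^(1/2), the vector Sigma^(1/2) Z is Sigma0^(1/2) applied to M Z, and
    the law of M Z is absolutely continuous with respect to that of Z. *)
Lemma gaussian_sample_null_set n Sigma0 Sigma (N : set (n.-tuple 'cV[R]_p)) :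
  posdefmx Sigma0 -> posdefmx Sigma -> measurable N ->
  gaussian_sample n Sigma0 N = 0 -> gaussian_sample n Sigma N = 0.
Proof.
move=> S0pd Spd mN.
rewrite -(setIT N) -!integral_indic//; apply: integral_product_law_null.
- move=> _ h mh h0.
  have mhM (M : 'M[R]_p) : measurable_fun setT (fun v => h (M *m v)%R).
    exact: measurableT_comp mh (measurable_mulmx_l M).
  rewrite !ge0_integral_gaussian// => h_null.
  have S0u := sqrtmx_unit S0pd; have Su := sqrtmx_unit Spd.
  have Mu : (invmx (sqrtmx Sigma0) *m sqrtmx Sigma)%R \in unitmx.
    by rewrite unitmx_mul unitmx_inv S0u.
  rewrite -[RHS](std_normal_null_linear Mu (mhM (sqrtmx Sigma0)) _ h_null)//.
  by apply: eq_integral => z _; rewrite !mulmxA mulmxV// mul1mx.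
- exact/measurable_EFinP/measurable_indic.
- by [].
Qed.

End whitening.

(** * The statistics *)
Section statistic_identity.
Context {R : realType} {n p : nat}.

Lemma sum_pair_sym (F : 'I_p -> 'I_p -> R) : (forall i j, F i j = F j i) ->
  \sum_i \sum_j F i j =
  2 * (\sum_(i < p) \sum_(j < p | (i < j)%N) F i j) + \sum_i F i i.
Proof.
move=> Fsym.
have split_row i : \sum_j F i j =
    \sum_(j < p | (i < j)%N) F i j + (\sum_(j < p | (j < i)%N) F i j + F i i).
  rewrite (bigID (fun j : 'I_p => (i < j)%N))/=; congr (_ + _).
  rewrite (bigD1 i) ?ltnn//= addrC; congr (_ + _); apply: eq_bigl => j.
  by rewrite -leqNgt andbC -ltn_neqAle.
under eq_bigr do rewrite split_row; rewrite !big_split/= addrA; congr (_ + _).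
rewrite mulr_natl mulr2n; congr (_ + _).
rewrite (exchange_big_dep xpredT)//=; apply: eq_bigr => i _.
by apply: eq_bigr => j _; rewrite Fsym.
Qed.

(** The kernel h for the null covariance I. *)
Definition white_kernel (y z : 'cV[R]_p) : R :=
  ((y^T *m z) 0 0) ^+ 2 - (y^T *m y) 0 0 - (z^T *m z) 0 0 + p%:R.

(** The off-diagonal terms of the squared inner product pair up; its diagonal
    terms absorb the remaining terms of the kernel into the products of the
    z_i^2 - 1 and y_i^2 - 1. *)
Lemma white_kernelE (y z : 'cV[R]_p) :
  white_kernel y z =
  2 * (\sum_(i < p) \sum_(j < p | (i < j)%N) z i 0 * z j 0 * (y i 0 * y j 0)) +
  \sum_(i < p) (z i 0 ^+ 2 - 1) * (y i 0 ^+ 2 - 1).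
Proof.
have dotE (u v : 'cV[R]_p) : (u^T *m v) 0 0 = \sum_i u i 0 * v i 0.
  by rewrite mxE; apply: eq_bigr => i _; rewrite mxE.
have diagE : \sum_(i < p) (z i 0 ^+ 2 - 1) * (y i 0 ^+ 2 - 1) =
    \sum_i z i 0 * z i 0 * (y i 0 * y i 0) - \sum_i y i 0 * y i 0
    - \sum_i z i 0 * z i 0 + p%:R.
  rewrite -[p in p%:R]card_ord -sum1_card natr_sum -!sumrB -big_split/=.
  by apply: eq_bigr => i _; ring.
rewrite /white_kernel !dotE diagE !addrA; congr (_ - _ - _ + _).
rewrite -sum_pair_sym => [|i j]; last by rewrite [z i 0 * _]mulrC [y i 0 * _]mulrC.
rewrite expr2 mulr_suml; apply: eq_bigr => i _; rewrite mulr_sumr.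
by apply: eq_bigr => j _; ring.
Qed.

(** The inner sum is empty for t = 0. *)
Lemma sum_pos_index (F : 'I_n -> 'I_n -> R) :
  \sum_(t < n | (0 < t)%N) \sum_(s < n | (s < t)%N) F t s =
  \sum_(t < n) \sum_(s < n | (s < t)%N) F t s.
Proof.
rewrite [RHS](bigID (fun t : 'I_n => (0 < t)%N))/= [X in _ + X]big1 ?addr0// => t.
by rewrite -eqn0Ngt => /eqP ->; rewrite big_pred0.
Qed.

Lemma U_statE (y : n.-tuple 'cV[R]_p) :
  U_stat y = (2 * n%:R ^+ 2)^-1 *
    (\sum_(t < n) \sum_(s < n | (s < t)%N) white_kernel (tnth y s) (tnth y t)).
Proof.
under eq_bigr do under eq_bigr do rewrite white_kernelE.
under eq_bigr do rewrite big_split/=; rewrite big_split mulrDr /U_stat; congr (_ + _).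
- have -> : (n%:R ^+ 2)^-1 = (2 * n%:R ^+ 2)^-1 * 2 :> R.
    by rewrite [RHS]mulrC (invfM 2) mulVKf.
  rewrite -mulrA; congr (_ * _).
  under [in RHS]eq_bigr do rewrite -mulr_sumr.
  rewrite -mulr_sumr; congr (_ * _).
  transitivity (\sum_(i < p) \sum_(j < p | (i < j)%N) \sum_(t < n) \sum_(s < n | (s < t)%N)
       tnth y t i 0 * tnth y t j 0 * (tnth y s i 0 * tnth y s j 0)).
    apply: eq_bigr => i _; apply: eq_bigr => j _; rewrite -sum_pos_index.
    by apply: eq_bigr => t _; rewrite mulr_sumr.
  under eq_bigr do rewrite exchange_big/=.
  rewrite exchange_big/=; apply: eq_bigr => t _.
  under eq_bigr do rewrite exchange_big/=.
  by rewrite exchange_big.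
- congr (_ * _).
  transitivity (\sum_(i < p) \sum_(t < n) \sum_(s < n | (s < t)%N)
       (tnth y t i 0 ^+ 2 - 1) * (tnth y s i 0 ^+ 2 - 1)).
    apply: eq_bigr => i _; rewrite -sum_pos_index.
    by apply: eq_bigr => t _; rewrite mulr_sumr.
  rewrite exchange_big/=; apply: eq_bigr => t _.
  by rewrite exchange_big.
Qed.

Lemma U_stat_at_whiten (Sigma0 : 'M[R]_p) (x : n.-tuple 'cV[R]_p) :
  posdefmx Sigma0 -> U_stat_at Sigma0 x = U_stat (whiten Sigma0 x).
Proof.
move=> S0pd; rewrite U_statE /U_stat_at; congr (_ * _).
apply: eq_bigr => t _; apply: eq_bigr => s _; rewrite !tnth_mktuple.
have qE (u v : 'cV[R]_p) : (invsqrtmx Sigma0 *m u)^T *m (invsqrtmx Sigma0 *m v) =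
    u^T *m invmx Sigma0 *m v.
  by rewrite trmx_mul invsqrtmx_sym// -invsqrtmx_sqr// !mulmxA.
by rewrite /h_kernel /white_kernel !qE.
Qed.

End statistic_identity.

(** * Likelihood ratios *)
Section likelihood_ratios.
Context {R : realType}.

Lemma measurable_symmetric_matrices p : measurable [set H : 'M[R]_p | H^T = H].
Proof.
rewrite [X in measurable X](_ : _ =
  \bigcap_(ij in [set: 'I_p * 'I_p]) [set H : 'M[R]_p | H ij.2 ij.1 = H ij.1 ij.2]).
  apply: fin_bigcap_measurable => [|[i j] _ /=]; first exact: finite_finset.
  rewrite [X in measurable X](_ : _ =
    (fun H : 'M[R]_p => H j i - H i j) @^-1` [set 0]).
    rewrite -[X in measurable X]setTI.
    suff mf : measurable_fun setT (fun H : 'M[R]_p => H j i - H i j) by exact: mf.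
    by apply: measurable_funB; exact: measurable_mx_entry.
  by apply/seteqP; split => H /= /eqP; [rewrite -subr_eq0|rewrite subr_eq0] => /eqP.
apply/seteqP; split => [H /= Hsym [i j] _ /=|H /= Hsym].
  by rewrite -{1}Hsym mxE.
by apply/matrixP => i j; rewrite mxE; exact: (Hsym (i, j)).
Qed.

(** At the full sample space the integrand is the constant 1, whether or not the
    probability of a general event under P_{n, V H} is measurable in H. *)
Lemma goe_mixture_le1 n p (V : 'M[R]_p -> 'M[R]_p) :
  (goe_mixture V [set: n.-tuple 'cV[R]_p] <= 1)%E.
Proof.
rewrite /goe_mixture; under eq_integral do rewrite probability_setT.
rewrite integral_cst; last exact: measurable_symmetric_matrices.
by rewrite mul1e probability_le1//; exact: measurable_symmetric_matrices.
Qed.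

(** Finiteness of nu makes g integrable, and integrable functions with the same
    integrals over measurable sets agree almost everywhere. *)
Lemma likelihood_ratio_unique d (T : measurableType d) (nu : set T -> \bar R)
    (P : probability T R) (g h : T -> \bar R) : (nu setT < +oo)%E ->
  is_likelihood_ratio nu P g -> is_likelihood_ratio nu P h ->
  {ae P, forall x, g x = h x}.
Proof.
move=> nuT [mg g0 gE] [mh h0 hE].
have : ae_eq P setT g h.
  apply: integral_ae_eq => //; last by move=> B _ mB; rewrite -gE// hE.
  apply/integrableP; split => //.
  by under eq_integral do rewrite gee0_abs//; rewrite -gE.
by apply: filterS => x; apply.
Qed.

Definition unwhiten n p (Sigma0 : 'M[R]_p) (y : n.-tuple 'cV[R]_p) :=
  map_tuple (mulmx (sqrtmx Sigma0)) y.

Lemma measurable_unwhiten n p (Sigma0 : 'M[R]_p) :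
  measurable_fun setT (@unwhiten n p Sigma0).
Proof. exact: measurable_map_tuple (measurable_mulmx_l _). Qed.

Lemma whitenK n p (Sigma0 : 'M[R]_p) : posdefmx Sigma0 ->
  cancel (@whiten R p n Sigma0) (unwhiten Sigma0).
Proof.
move=> S0pd x; apply: eq_from_tnth => t; rewrite tnth_map tnth_mktuple.
by rewrite mulKVmx// sqrtmx_unit.
Qed.

Section whitened_alternative.
Variables (n p : nat) (omega : R) (Sigma0 : 'M[R]_p).
Hypothesis S0pd : posdefmx Sigma0.

Lemma posdefmx_Sigma_omega (H : 'M[R]_p) : H^T = H -> posdefmx (Sigma_omega n omega H).
Proof. by move=> Hsym; apply: posdefmx_inv; exact: posdefmx_precision_omega. Qed.

Lemma posdefmx_Sigma_omega_at (H : 'M[R]_p) : H^T = H ->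
  posdefmx (Sigma_omega_at n omega Sigma0 H).
Proof.
move=> Hsym; apply: posdefmx_inv; rewrite -{1}(invsqrtmx_sym S0pd).
by apply: posdefmx_congr; [exact: posdefmx_precision_omega|exact: invsqrtmx_unit].
Qed.

Lemma Sigma_omega_at_whitens (H : 'M[R]_p) : H^T = H ->
  invsqrtmx Sigma0 *m Sigma_omega_at n omega Sigma0 H *m invsqrtmx Sigma0 =
  Sigma_omega n omega H.
Proof.
move=> Hsym; have Tu := invsqrtmx_unit S0pd.
have Pu := posdefmx_unit (posdefmx_precision_omega n omega Hsym).
rewrite /Sigma_omega_at /Sigma_omega -[LHS](mulmxK Pu).
set T := invsqrtmx Sigma0 in Tu *; set P := precision_omega n omega H in Pu *.
pose Q := T *m P *m T; have Qu : Q \in unitmx by rewrite !unitmx_mul Tu Pu.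
suff E : T *m invmx Q *m T *m P = 1%:M by rewrite E mul1mx.
transitivity (T *m invmx Q *m Q *m invmx T); last by rewrite mulmxKV// mulmxV.
by rewrite /Q !mulmxA mulmxK.
Qed.

Lemma goe_mixture_whiten (B : set (n.-tuple 'cV[R]_p)) : measurable B ->
  goe_mixture (Sigma_omega_at n omega Sigma0) (whiten Sigma0 @^-1` B) =
  goe_mixture (Sigma_omega n omega) B.
Proof.
move=> mB; apply: eq_integral => H /set_mem/= Hsym.
apply: gaussian_sample_whiten => //.
- exact: posdefmx_Sigma_omega_at.
- exact: posdefmx_Sigma_omega.
- exact: Sigma_omega_at_whitens.
Qed.

Lemma gaussian_sample_whiten_at_null (B : set (n.-tuple 'cV[R]_p)) : measurable B ->
  gaussian_sample n Sigma0 (whiten Sigma0 @^-1` B) = gaussian_sample n 1%:M B.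
Proof.
move=> mB; apply: gaussian_sample_whiten => //; first exact: posdefmx1.
exact: invsqrtmx_whitens.
Qed.

(** Every event B is the preimage of an event B' under the bijection given by
    whitening, and both measures of B are those of B' in the whitened
    experiment. *)
Lemma likelihood_ratio_whiten (g : n.-tuple 'cV[R]_p -> \bar R) :
  is_likelihood_ratio (goe_mixture (Sigma_omega n omega)) (gaussian_sample n 1%:M) g ->
  is_likelihood_ratio (goe_mixture (Sigma_omega_at n omega Sigma0))
    (gaussian_sample n Sigma0) (g \o whiten Sigma0).
Proof.
have mw := @measurable_whiten R p n Sigma0.
move=> [mg g0 gE]; split; first exact: measurableT_comp mg mw.
  by move=> x; exact: g0.
move=> B mB; pose B' := unwhiten Sigma0 @^-1` B.
have BE : whiten Sigma0 @^-1` B' = B.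
  by apply/seteqP; split => x; rewrite /B' /= whitenK.
have mB' : measurable B'.
  by rewrite -[X in measurable X]setTI; exact: measurable_unwhiten.
rewrite -BE goe_mixture_whiten// gE//.
rewrite -(ge0_integral_pushforward mw)//; last exact: measurable_funTS.
by apply: eq_measure_integral => A mA _; exact/esym/gaussian_sample_whiten_at_null.
Qed.

Lemma ae_gaussian_sample (Sigma : 'M[R]_p) (E : n.-tuple 'cV[R]_p -> Prop) :
  posdefmx Sigma -> {ae gaussian_sample n Sigma0, forall x, E x} ->
  {ae gaussian_sample n Sigma, forall x, E x}.
Proof.
move=> Spd [N [mN N0 sN]]; exists N; split => //.
exact: (gaussian_sample_null_set S0pd).
Qed.

End whitened_alternative.
End likelihood_ratios.

Unset Implicit Arguments.

Theorem lemma1 (R : realType) (n p : nat) (n_gt0 : (0 < n)%N)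
    (p_gt0 : (0 < p)%N) (Sigma0 : 'M[R]_p) (Sigma0_pd : posdefmx Sigma0)
    (omega : R) (omega_ge0 : 0 <= omega) :
  [/\ (* (i) *)
      (forall B : set (n.-tuple 'cV[R]_p), measurable B ->
         distribution (gaussian_sample n Sigma0) (whiten Sigma0) B =
         gaussian_sample n 1%:M B) /\
      (forall H : 'M[R]_p, H^T = H ->
         forall B : set (n.-tuple 'cV[R]_p), measurable B ->
         distribution (gaussian_sample n (Sigma_omega_at n omega Sigma0 H))
           (whiten Sigma0) B =
         gaussian_sample n (Sigma_omega n omega H) B),
      (* (ii) *)
      (forall g g0 : n.-tuple 'cV[R]_p -> \bar R,
         is_likelihood_ratio (goe_mixture (Sigma_omega n omega))
           (gaussian_sample n 1%:M) g ->
         is_likelihood_ratio (goe_mixture (Sigma_omega_at n omega Sigma0))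
           (gaussian_sample n Sigma0) g0 ->
         forall Sigma : 'M[R]_p, posdefmx Sigma ->
         {ae gaussian_sample n Sigma,
           forall x, g0 x = g (whiten Sigma0 x)}) &
      (* (iii) *)
      (forall Sigma : 'M[R]_p, posdefmx Sigma ->
         {ae gaussian_sample n Sigma,
           forall x, U_stat_at Sigma0 x = U_stat (whiten Sigma0 x)})].
Proof.
split; [split| |].
- by move=> B mB; exact: gaussian_sample_whiten_at_null.
- move=> H Hsym B mB; apply: gaussian_sample_whiten => //.
  + exact: posdefmx_Sigma_omega_at.
  + exact: posdefmx_Sigma_omega.
  + exact: Sigma_omega_at_whitens.
- move=> g g0 gLR g0LR Sigma Spd; apply: (ae_gaussian_sample Sigma0_pd Spd).
  apply: likelihood_ratio_unique g0LR (likelihood_ratio_whiten Sigma0_pd gLR).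
  exact: le_lt_trans (goe_mixture_le1 _ _) (ltry 1).
- by move=> Sigma _; apply: aeW => x; exact: U_stat_at_whiten.
Qed.
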